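(* Let $n\ge4$ be an integer and let $l_1\ne l_2$ be natural numbers with $0<l_i<\tfrac n2$ and $l_i\ne\tfrac n3$ for $i=1,2$. Then the trivial equilibrium $x_F=(F,\dots,F)$ of the Lorenz-96 model exhibits a Hopf-Hopf bifurcation for the $l_1$-th and $l_2$-th eigenvalue pairs at a parameter value $F_{\mathrm{HH}}:=F_{\mathrm H}(l_1,n)=F_{\mathrm H}(l_2,n)$ if and only if $$\cos\tfrac{2\pi l_1}{n}+\cos\tfrac{2\pi l_2}{n}=\tfrac12 .$$
   Context: The Lorenz-96 model of dimension $n$ with parameter $F\in\mathbb{R}$ is the system of ordinary differential equations $\dot x_j = x_{j-1}(x_{j+1}-x_{j-2})-x_j+F$, $j=1,\dots,n$, with indices taken modulo $n$. It has the trivial equilibrium $x_F=(F,\dots,F)$. Put $$f(j,n)=\cos\tfrac{2\pi j}{n}-\cos\tfrac{4\pi j}{n},\qquad g(j,n)=-\sin\tfrac{2\pi j}{n}-\sin\tfrac{4\pi j}{n}.$$ For $n\ge4$ the eigenvalues of the Jacobian matrix at $x_F$ are $\lambda_j(F,n)=-1+F f(j,n)+iF g(j,n)$, $j=0,\dots,n-1$, and $\lambda_{n-j}=\overline{\lambda_j}$ for $1\le j\le n-1$. The pair $\{\lambda_j,\lambda_{n-j}\}$ is called the $j$-th eigenvalue pair. For $0<l<\tfrac n2$, $l\ne\tfrac n3$, put $F_{\mathrm H}(l,n)=1/f(l,n)$; this is the value of $F$ at which the real part of the $l$-th eigenvalue pair vanishes. In the paper, a Hopf-Hopf bifurcation for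 two distinct eigenvalue pairs (with indices $l_1\neq l_2$) means that both pairs cross the imaginary axis transversally (real part zero, with nonzero derivative with respect to $F$) at one and the same parameter value, so that $F_{\mathrm H}(l_1,n)=F_{\mathrm H}(l_2,n)$; this common value is denoted $F_{\mathrm{HH}}$. *)

(* Defs.v *)
From HB Require Import structures.
From mathcomp Require Import all_boot all_order all_algebra.
From mathcomp Require Import all_classical all_reals all_analysis.
From mathcomp Require Import complex.

Set Implicit Arguments.
Unset Strict Implicit.
Unset Printing Implicit Defensive.

Import Order.TTheory GRing.Theory Num.Theory.
Import numFieldNormedType.Exports.

Local Open Scope ring_scope.
Local Open Scope complex_scope.

(* Coordinates are numbered 0, ..., n-1 instead of 1, ..., n; [ordS] and
   [ord_pred] are the successor and predecessor modulo n. *)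
Definition lorenz96 (R : realType) (n : nat) (F : R) (x : 'rV[R]_n) : 'rV[R]_n :=
  \row_j (x 0 (ord_pred j) * (x 0 (ordS j) - x 0 (ord_pred (ord_pred j)))
          - x 0 j + F).

Definition trivial_equilibrium (R : realType) (n : nat) (F : R) : 'rV[R]_n :=
  const_mx F.

Definition l96_f (R : realType) (j n : nat) : R :=
  cos (2 * pi * j%:R / n%:R) - cos (4 * pi * j%:R / n%:R).

Definition l96_g (R : realType) (j n : nat) : R :=
  - sin (2 * pi * j%:R / n%:R) - sin (4 * pi * j%:R / n%:R).

Definition l96_eigenvalue (R : realType) (n j : nat) (F : R) : R[i] :=
  (-1 + F * l96_f R j n) +i* (F * l96_g R j n).

Definition F_H (R : realType) (l n : nat) : R := 1 / l96_f R l n.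

(* [lam j F], for j < n, lists with multiplicity the complex eigenvalues of the
   linearization of [f F] at [xeq F].  With row vectors, ['J] is the transpose
   of the usual Jacobian matrix, which does not affect the spectrum; it is
   meaningful only for a differentiable map, whence the first conjunct. *)
Definition jacobian_spectrum (R : realType) (n : nat)
    (f : R -> 'rV[R]_n -> 'rV[R]_n) (xeq : R -> 'rV[R]_n)
    (lam : nat -> R -> R[i]) : Prop :=
  forall F : R, differentiable (f F) (xeq F) /\
    char_poly (map_mx (real_complex R) ('J (f F) (xeq F)))
      = \prod_(j < n) ('X - (lam j F)%:P).

(* The l-th eigenvalue pair consists of the eigenvalues numbered l and n - l. *)
Definition pair_crosses (R : realType) (n : nat)
    (lam : nat -> R -> R[i]) (l : nat) (F0 : R) : Prop :=
  forall k : nat, k \in [:: l; (n - l)%N] ->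
    [/\ complex.Re (lam k F0) = 0,
        derivable (fun F : R => complex.Re (lam k F)) F0 1
      & derive1 (fun F : R => complex.Re (lam k F)) F0 != 0].

Definition hopf_hopf (R : realType) (n : nat)
    (f : R -> 'rV[R]_n -> 'rV[R]_n) (xeq : R -> 'rV[R]_n)
    (lam : nat -> R -> R[i]) (l1 l2 : nat) (F0 : R) : Prop :=
  [/\ forall F : R, f F (xeq F) = 0,
      jacobian_spectrum f xeq lam,
      l1 != l2,
      pair_crosses n lam l1 F0
    & pair_crosses n lam l2 F0].

(* Main.v *)
Require Import Defs.
From HB Require Import structures.
From mathcomp Require Import all_boot all_order all_algebra.
From mathcomp Require Import all_classical all_reals all_analysis.
From mathcomp Require Import complex.
From mathcomp Require Import ring lra.

Set Implicit Arguments.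
Unset Strict Implicit.
Unset Printing Implicit Defensive.

Import Order.TTheory GRing.Theory Num.Theory.
Import numFieldNormedType.Exports.

Local Open Scope ring_scope.
Local Open Scope complex_scope.

(** Put c_i = cos (2 pi l_i / n).  By the double-angle formula
    f(l, n) = (1 - c) (1 + 2 c), hence
      f(l1, n) - f(l2, n) = 2 (c1 - c2) (1/2 - (c1 + c2)).
    The angles 2 pi l_i / n are distinct and lie in (0, pi), where cos is
    injective, so c1 <> c2, and the two parameter values 1 / f(l_i, n) agree
    exactly when c1 + c2 = 1/2.

    What remains is to see that a common value F_H(l, n) really is a Hopf-Hopf
    point.  The real part of the l-th pair is F |-> -1 + F f(l, n): it is affine
    with slope f(l, n), which vanishes only for l = n/3 in the range considered
    ([l96_f_neq0]), so the pair crosses the imaginary axis transversally at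
    1 / f(l, n) ([pair_crosses_F_H]).

    That the numbers -1 + F (f + i g) are the spectrum of the linearization, with
    multiplicities, is [jacobian_spectrum_lorenz96].  At an equilibrium with equal
    coordinates the linearization is the circulant
      v |-> (F (v_(j+1) - v_(j-2)) - v_j)_j ([jacobian_lorenz96]),
    so for every n-th root of unity w the vector (w^j)_j is an eigenvector, with
    eigenvalue F (w - w^-2) - 1.  Taking w among the n distinct powers of
    exp(-2 pi i / n) gives as eigenvectors the rows of a transposed Vandermonde
    matrix, which is invertible, and the characteristic polynomial is read off
    from the resulting diagonalization ([char_poly_eigenbasis]). *)

(** * Characteristic polynomials from a basis of eigenvectors *)

(** The relation V A = D V lifts to V (X - A) = (X - D) V over polynomials;
    there det V can be cancelled from the determinants, polynomials over a domain
    forming a domain. *)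
Lemma char_poly_eigenbasis (K : idomainType) (n : nat) (A V : 'M[K]_n)
    (d : 'rV[K]_n) :
  V *m A = diag_mx d *m V -> \det V != 0 ->
  char_poly A = \prod_(j < n) ('X - (d 0 j)%:P).
Proof.
move=> VA V0.
have intertwine :
    map_mx polyC V *m char_poly_mx A = char_poly_mx (diag_mx d) *m map_mx polyC V.
  by rewrite mulmxBr mulmxBl -!map_mxM VA mul_mx_scalar mul_scalar_mx.
have detV0 : \det (map_mx polyC V) != 0 by rewrite det_map_mx polyC_eq0.
have diagE : char_poly (diag_mx d) = \prod_(j < n) ('X - (d 0 j)%:P).
  rewrite char_poly_trig ?diag_mx_is_trig //.
  by apply: eq_bigr => j _; rewrite mxE eqxx.
rewrite -diagE; apply: (mulfI detV0).
by rewrite /char_poly -det_mulmx intertwine det_mulmx mulrC.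
Qed.

Lemma det_Vandermonde_neq0 (K : idomainType) (n : nat) (a : 'rV[K]_n) :
  injective (a 0) -> \det (Vandermonde n a) != 0.
Proof.
move=> inj_a; rewrite det_Vandermonde; apply/prodf_neq0 => i _.
apply/prodf_neq0 => j ltij; rewrite subr_eq0; apply: contraTneq ltij => /inj_a ->.
by rewrite ltnn.
Qed.

(** * Roots of unity *)

Definition cis (R : realType) (t : R) : R[i] := cos t +i* sin t.

Section Cis.
Variable R : realType.
Implicit Types t s : R.

Lemma cisD t s : cis (t + s) = cis t * cis s.
Proof.
rewrite /cis cosD sinD; apply/eqP; rewrite eq_complex /=.
by apply/andP; split; apply/eqP; ring.
Qed.

Lemma cis0 : cis (0 : R) = 1.
Proof. by rewrite /cis cos0 sin0. Qed.

Lemma cisX t k : cis t ^+ k = cis (k%:R * t).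
Proof.
elim: k => [|k IH]; first by rewrite mul0r cis0 expr0.
by rewrite exprS IH -cisD; congr cis; rewrite -natr1; ring.
Qed.

Lemma cis_neq0 t : cis t != 0.
Proof.
by have : cis t * cis (- t) != 0; [rewrite -cisD subrr cis0 oner_eq0 |
  rewrite mulf_eq0 negb_or => /andP[]].
Qed.

Lemma cos_lt1 t : 0 < t < 2 * pi -> cos t < 1.
Proof.
move=> /andP[t0 t2pi].
have hs : 0 < sin (t / 2) by apply: sin_gt0_pi; apply/andP; split; lra.
have -> : t = (t / 2) *+ 2 by rewrite -mulr_natr; field.
rewrite cos_mulr2n cos2sin2.
have := exprn_gt0 2 hs; lra.
Qed.

(** The negative angle makes the k-th power correspond to the k-th eigenvalue
    rather than to its conjugate, because [l96_g] carries minus signs. *)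
Definition unity_root (n : nat) : R[i] := cis (- (2 * pi / n%:R)).

Lemma unity_root_expn n : (0 < n)%N -> unity_root n ^+ n = 1.
Proof.
move=> n0; rewrite cisX.
have n0' : n%:R != 0 :> R by rewrite pnatr_eq0 -lt0n.
have -> : n%:R * - (2 * pi / n%:R) = - (pi *+ 2) :> R.
  by rewrite -mulr_natr; field.
by rewrite /cis cosN sinN cos2pi sin2pi oppr0.
Qed.

Lemma unity_root_expr_neq1 n d : (0 < d < n)%N -> unity_root n ^+ d != 1.
Proof.
move=> /andP[d0 dn]; rewrite cisX /cis; apply/negP => /eqP [] + _; apply/eqP.
rewrite lt_eqF // mulrN cosN cos_lt1 //.
have n0 : 0 < n%:R :> R by rewrite ltr0n (leq_trans _ dn).
have d0' : 0 < d%:R :> R by rewrite ltr0n.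
have dn' : d%:R < n%:R :> R by rewrite ltr_nat.
have pi0 : 0 < pi :> R by exact: pi_gt0.
rewrite mulrA; apply/andP; split; first by rewrite divr_gt0 // !mulr_gt0.
by rewrite ltr_pdivrMr // mulrC ltr_pM2l // mulr_gt0.
Qed.

(** Two equal powers would make a smaller power equal to 1, against the
    primitivity of the root. *)
Lemma unity_root_expr_inj n : injective (fun k : 'I_n => unity_root n ^+ k).
Proof.
have pow_neq (i j : 'I_n) : (i < j)%N -> unity_root n ^+ i != unity_root n ^+ j.
  move=> ltij; apply/negP => /eqP zij.
  have := @unity_root_expr_neq1 n (j - i).
  rewrite subn_gt0 ltij (leq_ltn_trans (leq_subr _ _) (ltn_ord j)) => /(_ isT).
  have zi : unity_root n ^+ i != 0 by rewrite expf_neq0 // cis_neq0.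
  by rewrite -(inj_eq (mulfI zi)) -exprD subnKC ?(ltnW ltij) // mulr1 zij eqxx.
move=> i j /= zij; apply: val_inj => /=.
by case: (ltngtP i j) => // /pow_neq; rewrite zij eqxx.
Qed.

End Cis.

(** Since w^n = 1, the wrap-around of the cyclic successor is invisible in the
    powers of w; this is what makes (w^j)_j an eigenvector of a circulant. *)
Lemma expr_ordS (K : nzRingType) (n : nat) (w : K) (j : 'I_n) :
  w ^+ n = 1 -> w ^+ ordS j = w * w ^+ j.
Proof. by move=> wn; rewrite /= expr_mod // exprS. Qed.

(** * The linearization at the trivial equilibrium *)

Section Jacobian.
Variables (R : realType) (n : nat).

(** Written with column selections of the identity, so that right multiplication
    of any matrix by it is a combination of cyclic column shifts: this serves both
    real tangent vectors and complex eigenvectors.  Rows index the variable that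
    is differentiated, columns the component of the vector field. *)
Definition l96_jacobian (F : R) : 'M[R]_n :=
  F *: (colsub (@ordS n) 1%:M - colsub (@ord_pred n \o @ord_pred n) 1%:M) - 1%:M.

Lemma is_derive_coord (x v : 'rV[R]_n) j :
  is_derive x v (fun y : 'rV[R]_n => y 0 j) (v 0 j).
Proof.
have did : derivable (id : 'rV[R]_n -> 'rV[R]_n) x v by exact: derivable_id.
apply: DeriveDef; first by move/derivable_mxP: did; exact.
by have /matrixP/(_ 0 j) := derive_mx did; rewrite derive_id mxE => ->.
Qed.

Lemma differentiable_row (V : normedModType R) (f : V -> 'rV[R]_n) x :
  (forall j, differentiable (fun y => f y 0 j) x) -> differentiable f x.
Proof.
move=> df.
have -> : f = \sum_(j < n) (fun y => f y 0 j *: delta_mx 0 j).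
  apply/funext => y; rewrite fct_sumE; exact: row_sum_delta.
by apply: differentiable_sum => j; apply: differentiableZl.
Qed.

(** A pointwise algebraic combination of coordinate functions, the form on which
    the rules for sums and products of functions operate. *)
Lemma lorenz96_coordE F j :
  (fun y : 'rV[R]_n => lorenz96 F y 0 j) =
    (fun y => y 0 (ord_pred j)) *
      ((fun y => y 0 (ordS j)) - (fun y => y 0 (ord_pred (ord_pred j))))
    - (fun y => y 0 j) + cst F.
Proof. by apply/funext => y; rewrite mxE. Qed.

Lemma differentiable_lorenz96 F (x : 'rV[R]_n) : differentiable (lorenz96 F) x.
Proof.
apply: differentiable_row => j; rewrite lorenz96_coordE.
have dc k : differentiable (fun y : 'rV[R]_n => y 0 k : R) x.
  exact: differentiable_coord.
exact: differentiableD (differentiableB (differentiableM (dc _)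
  (differentiableB (dc _) (dc _))) (dc _)) (differentiable_cst _ _).
Qed.

Lemma derive_lorenz96_coord F (x v : 'rV[R]_n) j :
  'D_v (fun y : 'rV[R]_n => lorenz96 F y 0 j) x =
    x 0 (ord_pred j) * (v 0 (ordS j) - v 0 (ord_pred (ord_pred j)))
    + (x 0 (ordS j) - x 0 (ord_pred (ord_pred j))) * v 0 (ord_pred j) - v 0 j.
Proof.
have dc := is_derive_coord x v.
rewrite lorenz96_coordE.
have := is_deriveD (is_deriveB (is_deriveM (dc (ord_pred j))
  (is_deriveB (dc (ordS j)) (dc (ord_pred (ord_pred j))))) (dc j))
  (is_derive_cst F x v).
by move=> /@derive_val ->; rewrite addr0.
Qed.

(** At equal coordinates the factor x_(j+1) - x_(j-2) vanishes, which removes the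
    term in v_(j-1) from the derivative. *)
Lemma jacobian_lorenz96 F :
  'J (lorenz96 F) (trivial_equilibrium n F) = l96_jacobian F.
Proof.
have dF := differentiable_lorenz96 F (trivial_equilibrium n F).
suff actE (v : 'rV[R]_n) :
    v *m 'J (lorenz96 F) (trivial_equilibrium n F) = v *m l96_jacobian F.
  by apply/row_matrixP => i; rewrite !rowE actE.
rewrite -deriveEjacobian // derive_mx; last exact: diff_derivable.
rewrite mulmxBr -scalemxAr mulmxBr !mulmx_colsub mulmx1.
apply/rowP => j; rewrite !mxE derive_lorenz96_coord !mxE /=.
by rewrite subrr mul0r addr0.
Qed.

End Jacobian.

(** * The spectrum *)

(** The k-th row of the transposed Vandermonde matrix on the powers of the root of
    unity is the eigenvector (w^j)_j with w the k-th power. *)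
Lemma jacobian_spectrum_lorenz96 (R : realType) (n : nat) : (0 < n)%N ->
  jacobian_spectrum (@lorenz96 R n) (@trivial_equilibrium R n) (l96_eigenvalue n).
Proof.
move=> n0 F; split; first exact: differentiable_lorenz96.
rewrite jacobian_lorenz96.
pose z := unity_root R n.
pose a : 'rV[R[i]]_n := \row_k z ^+ k.
pose d : 'rV[R[i]]_n := \row_k l96_eigenvalue n k F.
rewrite (@char_poly_eigenbasis _ _ _ (Vandermonde n a)^T d).
- by apply: eq_bigr => j _; rewrite mxE.
- rewrite /l96_jacobian map_mxB map_mxZ map_mxB !map_mxsub map_mx1.
  rewrite mulmxBr -scalemxAr mulmxBr !mulmx_colsub mulmx1.
  apply/matrixP => k j; rewrite mul_diag_mx !mxE /=.
  set w := z ^+ k.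
  have wn : w ^+ n = 1 by rewrite exprAC unity_root_expn // expr1n.
  (* Expressing every entry through the one of smallest shift, j - 2, avoids
     negative powers of w. *)
  set y := w ^+ ord_pred (ord_pred j).
  have wj : w ^+ j = w * (w * y).
    by rewrite -{1}(ord_predK j) expr_ordS // -{1}(ord_predK (ord_pred j)) expr_ordS.
  rewrite (expr_ordS _ wn) wj.
  set t := 2 * pi * k%:R / n%:R : R.
  have wE : w = cis (- t) by rewrite /w cisX; congr cis; rewrite /t; ring.
  have lamE : l96_eigenvalue n k F = F%:C * (w - cis (t *+ 2)) - 1.
    rewrite wE /l96_eigenvalue /l96_f /l96_g /cis.
    have -> : 4 * pi * k%:R / n%:R = t *+ 2 by rewrite /t; ring.
    rewrite -/t cosN sinN; apply/eqP; rewrite eq_complex /=; apply/andP; split.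
      by apply/eqP; simpc; ring.
    by apply/eqP; simpc; ring.
  have w2 : cis (t *+ 2) * (w * w) = 1.
    by rewrite wE -!cisD -[RHS](cis0 R); congr cis; ring.
  rewrite lamE mulrBl mul1r -!mulrA mulrBl.
  by rewrite !mulrA -(mulrA (cis _)) w2 mul1r.
- rewrite det_tr; apply: det_Vandermonde_neq0 => i j; rewrite !mxE.
  exact: unity_root_expr_inj.
Qed.

(** * Transversal crossing of the eigenvalue pairs *)

Section Frequencies.
Variable R : realType.

Lemma l96_fE j n : l96_f R j n =
  let c := cos (2 * pi * j%:R / n%:R) in (1 - c) * (1 + 2 * c).
Proof.
rewrite /l96_f /=; set t := 2 * pi * j%:R / n%:R.
have -> : 4 * pi * j%:R / n%:R = t *+ 2 by rewrite /t; ring.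
rewrite cos_mulr2n; ring.
Qed.

Lemma cos_2piB (t : R) : cos (2 * pi - t) = cos t.
Proof.
have -> : 2 * pi - t = - t + pi *+ 2 by ring.
by rewrite cosD2pi cosN.
Qed.

(** The angles of l and n - l add up to 2 pi, so both members of an eigenvalue
    pair have the same real part. *)
Lemma l96_f_conj l n : (0 < n)%N -> (l <= n)%N -> l96_f R (n - l) n = l96_f R l n.
Proof.
move=> n0 ln; rewrite !l96_fE /=.
have n0' : n%:R != 0 :> R by rewrite pnatr_eq0 -lt0n.
have -> : 2 * pi * (n - l)%N%:R / n%:R = 2 * pi - 2 * pi * l%:R / n%:R :> R.
  by rewrite natrB //; field.
by rewrite cos_2piB.
Qed.

Lemma angle_gt0_ltpi l n : (0 < l)%N -> l%:R < n%:R / 2 :> R ->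
  0 < 2 * (pi : R) * l%:R / n%:R < pi.
Proof.
move=> l0 ln2.
have l0' : 0 < l%:R :> R by rewrite ltr0n.
have n0 : 0 < n%:R :> R by lra.
have pi0 : 0 < pi :> R by exact: pi_gt0.
apply/andP; split; first by rewrite divr_gt0 // !mulr_gt0.
rewrite ltr_pdivrMr // [2 * _]mulrC -mulrA ltr_pM2l //; lra.
Qed.

(** If f vanishes then cos t = cos (2 t) for the angle t of l in (0, pi).
    Injectivity of cos on [0, pi] forces t = 2 t, which is absurd, or
    t = 2 pi - 2 t, that is l = n / 3. *)
Lemma l96_f_neq0 l n : (0 < l)%N -> l%:R < n%:R / 2 :> R ->
  l%:R != n%:R / 3 :> R -> l96_f R l n != 0.
Proof.
move=> l0 ln2; apply: contra_neq => f0.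
have l0' : 0 < l%:R :> R by rewrite ltr0n.
have n0 : n%:R != 0 :> R by apply: lt0r_neq0; lra.
have pi0 : pi != 0 :> R by rewrite gt_eqF // pi_gt0.
have := angle_gt0_ltpi l0 ln2; move: f0; rewrite /l96_f.
set t := 2 * pi * l%:R / n%:R.
have -> : 4 * pi * l%:R / n%:R = 2 * t by rewrite /t; ring.
move=> /subr0_eq ct /andP[t_gt0 t_lt].
have [le2t|gt2t] := leP (2 * t) pi.
  have /cos_inj : t \in `[0, pi] by rewrite in_itv /=; apply/andP; split; lra.
  by move=> /(_ (2 * t)); rewrite in_itv /= => /(_ ltac:(apply/andP; split; lra) ct); lra.
have : t = 2 * pi - 2 * t.
  by apply: cos_inj; rewrite ?cos_2piB // in_itv /=; apply/andP; split; lra.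
move=> t3; have : 3 * t = 2 * pi by lra.
have -> : 3 * t = 2 * pi * (3 * l%:R / n%:R) by rewrite /t; ring.
rewrite -[X in _ = X]mulr1 => /(mulfI (mulf_neq0 _ pi0)) e.
have := e ltac:(by rewrite pnatr_eq0); move/(canRL (mulfVK n0)); lra.
Qed.

Lemma pair_crosses_F_H l n : (0 < l)%N -> l%:R < n%:R / 2 :> R ->
  l%:R != n%:R / 3 :> R -> pair_crosses n (@l96_eigenvalue R n) l (F_H R l n).
Proof.
move=> l0 ln2 ln3 k k_pair.
have ln : (l <= n)%N.
  rewrite -(ler_nat R); have l0' : 0 < l%:R :> R by rewrite ltr0n.
  lra.
have f0 := l96_f_neq0 l0 ln2 ln3.
have fk : l96_f R k n = l96_f R l n.
  by move: k_pair; rewrite !inE => /orP[] /eqP -> //; rewrite l96_f_conj // (leq_trans l0).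
have lamE : (fun F : R => complex.Re (l96_eigenvalue n k F)) =
    cst (-1) + (id : R -> R) * cst (l96_f R l n).
  by apply/funext => F; rewrite /= fk.
have dlam : is_derive (F_H R l n) 1
    (fun F : R => complex.Re (l96_eigenvalue n k F)) (l96_f R l n).
  rewrite lamE; apply: is_derive_eq.
  by rewrite /= scaler0 !add0r; exact: mulr1.
split.
- by rewrite /= fk /F_H div1r mulVf // addrC subrr.
- exact: ex_derive.
- by rewrite derive1E derive_val.
Qed.

End Frequencies.

(** * The Hopf-Hopf condition *)

Lemma lorenz96_equilibrium (R : realType) (n : nat) (F : R) :
  lorenz96 F (trivial_equilibrium n F) = 0.
Proof. by apply/rowP => j; rewrite !mxE subrr mulr0 sub0r addNr. Qed.

Theorem theorem2 (R : realType) (n l1 l2 : nat)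
    (hn : (4 <= n)%N) (hl : l1 != l2)
    (hl1 : (0 < l1)%N) (hl1n : l1%:R < n%:R / 2 :> R) (hl1n3 : l1%:R != n%:R / 3 :> R)
    (hl2 : (0 < l2)%N) (hl2n : l2%:R < n%:R / 2 :> R) (hl2n3 : l2%:R != n%:R / 3 :> R) :
  (exists F_HH : R,
      [/\ F_HH = F_H R l1 n, F_HH = F_H R l2 n
        & hopf_hopf (@lorenz96 R n) (@trivial_equilibrium R n)
                    (l96_eigenvalue n) l1 l2 F_HH])
  <-> cos (2 * pi * l1%:R / n%:R) + cos (2 * pi * l2%:R / n%:R) = 1 / 2 :> R.
Proof.
have n0 : (0 < n)%N by apply: leq_trans hn.
have n0' : n%:R != 0 :> R by rewrite pnatr_eq0 -lt0n.
have pi0 : 2 * pi != 0 :> R by rewrite mulf_neq0 ?pnatr_eq0 // gt_eqF // pi_gt0.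
set c1 := cos (2 * pi * l1%:R / n%:R); set c2 := cos (2 * pi * l2%:R / n%:R).
have c12 : c1 - c2 != 0.
  rewrite subr_eq0; apply: contra_neq hl => c12.
  have /andP[p1 q1] := angle_gt0_ltpi hl1 hl1n.
  have /andP[p2 q2] := angle_gt0_ltpi hl2 hl2n.
  have /(mulIf (invr_neq0 n0'))/(mulfI pi0)/eqP :
      2 * pi * l1%:R / n%:R = 2 * pi * l2%:R / n%:R :> R.
    by apply: cos_inj c12; rewrite in_itv /= ?ltW.
  by rewrite eqr_nat => /eqP.
have fB : l96_f R l1 n - l96_f R l2 n = 2 * (c1 - c2) * (1 / 2 - (c1 + c2)).
  by rewrite !l96_fE /= -/c1 -/c2; field.
split=> [[F [-> + _]]|c12E].
  rewrite /F_H !div1r => /invr_inj fE.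
  move: fB; rewrite fE subrr => /esym/eqP.
  by rewrite !mulf_eq0 (negbTE c12) pnatr_eq0 /= subr_eq0 div1r => /eqP <-.
have FE : F_H R l1 n = F_H R l2 n.
  by congr (1 / _); apply/eqP; rewrite -subr_eq0 fB c12E subrr mulr0.
exists (F_H R l1 n); split=> //; split=> //.
- exact: lorenz96_equilibrium.
- exact: jacobian_spectrum_lorenz96.
- exact: pair_crosses_F_H.
- by rewrite FE; exact: pair_crosses_F_H.
Qed.
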